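(* Let $E$ be a non-zero Banach space. Then $\mathrm{Mltp}(E)$ is a closed subset of $\mathrm{B}_2(E)$.
   Context: $\mathrm{B}_2(E)$ is the Banach space of bounded bilinear maps $E\times E\to E$ with the operator norm $|\varphi|=\sup\{\|\varphi(x,y)\|:\|x\|\leq1,\|y\|\leq1\}$. $\mathrm{Mltp}(E)\subset\mathrm{B}_2(E)$ is the set of continuous multiplications on $E$, i.e. of those $*\in\mathrm{B}_2(E)$ that are associative as binary operations on $E$. *)

(* Defs.v *)
From HB Require Import structures.
From mathcomp Require Import all_boot all_order all_algebra.
From mathcomp Require Import sesquilinear complex.
From mathcomp Require Import all_classical all_reals topology normedtype.

Set Implicit Arguments.
Unset Strict Implicit.
Unset Printing Implicit Defensive.

Import Order.TTheory GRing.Theory Num.Theory.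
Import numFieldNormedType.Exports.

Local Open Scope classical_set_scope.
Local Open Scope ring_scope.
Local Open Scope complex_scope.

(* Banach spaces are taken over the real or the complex numbers. *)
Variant scalar_kind := RealScalars | ComplexScalars.

Definition scalar_field (R : realType) (k : scalar_kind) : numFieldType :=
  match k with
  | RealScalars => R
  | ComplexScalars => R[i]
  end.

(* The norm of a module over [K] is valued in [K]; over the complex numbers the
   order is partial, but bounded sets of nonnegative elements still have a
   least upper bound. *)
Lemma scalar_supremums (R : realType) (k : scalar_kind)
    (A : set (scalar_field R k)) :
    A !=set0 -> (forall a, A a -> 0 <= a) -> has_ubound A ->
  supremums A !=set0.
Proof.
case: k A => /= A A0 Age0 [M AM].
  by exists (sup A); split; [apply: sup_upper_bound; split=> //; exists M
    |move=> b Ab; exact: ge_sup].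
pose B := [set complex.Re a | a in A].
have AB a : A a -> a = (complex.Re a)%:C.
  by move=> /Age0; case: a => x y; rewrite lecE /= => /andP[/eqP -> _].
have B0 : B !=set0 by case: A0 => a Aa; exists (complex.Re a), a.
have ubB b : ubound A b -> ubound B (complex.Re b).
  by move=> Ab _ [a /Ab + <-]; rewrite lecE => /andP[].
have supB : has_sup B by split=> //; exists (complex.Re M); exact: ubB.
exists (sup B)%:C; split.
  move=> a Aa; rewrite (AB _ Aa) lecE /= eqxx /=.
  by apply: sup_upper_bound => //; exists a.
move=> b Ab; case: (A0) => a Aa.
have := Ab _ Aa; rewrite (AB _ Aa) !lecE /= => /andP[-> _] /=.
by apply: ge_sup => //; exact: ubB.
Qed.

Section BoundedBilinear.
Variables (R : realType) (k : scalar_kind) (E : normedModType (scalar_field R k)).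

Definition unit_ball : set E := [set x | `|x| <= 1].

Definition bounded_bilinear : {pred E -> E -> E} :=
  [pred f | `[< bilinear_for *:%R *:%R f /\
     [bounded f p.1 p.2 | p in unit_ball `*` unit_ball] >]].

Lemma bounded_bilinearP (f : E -> E -> E) :
  f \in bounded_bilinear <->
  bilinear_for *:%R *:%R f /\
  exists M, forall x y, unit_ball x -> unit_ball y -> `|f x y| <= M.
Proof.
have u00 : (unit_ball `*` unit_ball) (0, 0).
  by split; rewrite /unit_ball /= normr0 ler01.
have PF := globally_properfilter u00.
split=> [/asboolP|] -[bf].
  move=> /ex_bound[M fM]; split=> //; exists M => x y ux uy.
  exact: (fM (x, y)).
move=> [M fM]; apply/asboolP; split=> //; apply/ex_bound; exists M => -[x y] [ux uy].
exact: fM.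
Qed.

Lemma bounded_bilinear_submod : submod_closed bounded_bilinear.
Proof.
split.
  apply/bounded_bilinearP; split; last by exists 0 => x y _ _; rewrite normr0.
  by split=> z a x y /=; rewrite scaler0 addr0.
move=> a f g /bounded_bilinearP[[fl fr] [M fM]].
move=> /bounded_bilinearP[[gl gr] [N gN]].
apply/bounded_bilinearP; split.
  split=> z b x y.
    have /= := fl z b x y; have /= := gl z b x y; rewrite /applyr => eg ef.
    change (a *: f (b *: x + y) z + g (b *: x + y) z =
      b *: (a *: f x z + g x z) + (a *: f y z + g y z)).
    by rewrite eg ef !scalerDr !scalerA (mulrC a) addrACA.
  have /= := fr z b x y; have /= := gr z b x y => eg ef.
  change (a *: f z (b *: x + y) + g z (b *: x + y) =
    b *: (a *: f z x + g z x) + (a *: f z y + g z y)).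
  by rewrite eg ef !scalerDr !scalerA (mulrC a) addrACA.
exists (`|a| * M + N) => x y ux uy.
change (`|a *: f x y + g x y| <= `|a| * M + N).
rewrite (le_trans (ler_normD _ _)) // lerD ?gN // normrZ.
by rewrite ler_wpM2l // fM.
Qed.

HB.instance Definition _ :=
  GRing.isSubmodClosed.Build _ _ bounded_bilinear bounded_bilinear_submod.

Record B2 := MkB2 { B2_fun :> E -> E -> E ; _ : B2_fun \in bounded_bilinear }.

HB.instance Definition _ := [isSub for B2_fun].
HB.instance Definition _ := [Choice of B2 by <:].
HB.instance Definition _ := [SubChoice_isSubLmodule of B2 by <:].

Definition B2_norm (f : B2) : scalar_field R k :=
  supremum 0 [set `|f x y| | x in unit_ball & y in unit_ball].

Lemma B2_norm_supremums (f : B2) :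
  supremums [set `|f x y| | x in unit_ball & y in unit_ball] (B2_norm f).
Proof.
rewrite /B2_norm; set A := [set _ | _ in _ & _ in _].
have A0 : A !=set0.
  by exists `|f 0 0|, 0; rewrite /unit_ball /= ?normr0 //; exists 0; rewrite ?normr0.
rewrite /supremum ifF; last by apply/eqP => /eqP; apply/negP/set0P.
case: xgetP => [a -> //|nA].
have /(_ A0)[] // := @scalar_supremums R k A.
- by move=> _ [x _ [y _ <-]].
- have /bounded_bilinearP[_ [M fM]] := valP f.
  by exists M => _ [x ux [y uy <-]]; exact: fM.
Qed.

Lemma ler_B2_norm (f : B2) x y :
  unit_ball x -> unit_ball y -> `|f x y| <= B2_norm f.
Proof. by move=> ux uy; apply: (B2_norm_supremums f).1; exists x => //; exists y. Qed.

Lemma B2_norm_le (f : B2) (M : scalar_field R k) :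
  (forall x y, unit_ball x -> unit_ball y -> `|f x y| <= M) -> B2_norm f <= M.
Proof.
by move=> fM; apply: (B2_norm_supremums f).2 => _ [x ux [y uy <-]]; exact: fM.
Qed.

Lemma B2_norm_ge0 (f : B2) : 0 <= B2_norm f.
Proof.
have u0 : unit_ball 0 by rewrite /unit_ball /= normr0.
exact: le_trans (normr_ge0 _) (ler_B2_norm f u0 u0).
Qed.

Lemma B2_normD (f g : B2) : B2_norm (f + g) <= B2_norm f + B2_norm g.
Proof.
apply: B2_norm_le => x y ux uy.
by rewrite (le_trans (ler_normD _ _)) // lerD // ler_B2_norm.
Qed.

Lemma B2_normZ (l : scalar_field R k) (f : B2) : B2_norm (l *: f) = `|l| * B2_norm f.
Proof.
have le_normZ (a : scalar_field R k) (g : B2) : B2_norm (a *: g) <= `|a| * B2_norm g.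
  apply: B2_norm_le => x y ux uy.
  change (`|a *: g x y| <= `|a| * B2_norm g).
  by rewrite normrZ ler_wpM2l // ler_B2_norm.
apply/eqP; rewrite eq_le le_normZ /=.
have [->|l0] := eqVneq l 0; first by rewrite normr0 mul0r B2_norm_ge0.
rewrite -ler_pdivlMl ?normr_gt0 //.
by have := le_normZ l^-1 (l *: f); rewrite scalerA mulVf // scale1r normfV.
Qed.

Lemma B2_norm_eq0 (f : B2) : B2_norm f = 0 -> f = 0.
Proof.
move=> f0; apply/val_inj/funext => x; apply/funext => y /=.
have [[fl fr] _] := (bounded_bilinearP f).1 (valP f).
have normalize (z : E) : exists2 c : scalar_field R k, c != 0 & unit_ball (c *: z).
  have [->|z0] := eqVneq z 0.
    by exists 1; rewrite ?oner_neq0 // /unit_ball /= scaler0 normr0.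
  exists `|z|^-1; first by rewrite invr_eq0 normr_eq0.
  by rewrite /unit_ball /= normrZ normfV normr_id mulVf // normr_eq0.
have [c c0 ucx] := normalize x; have [d d0 udy] := normalize y.
have /= frd := scalable_linear (fr (c *: x)) d y.
have /= flc := scalable_linear (fl y) c x.
have := ler_B2_norm f ucx udy.
rewrite f0 normr_le0 frd [f _ _]flc scalerA scaler_eq0 mulf_eq0.
by rewrite (negbTE c0) (negbTE d0) => /eqP.
Qed.

HB.instance Definition _ := Lmodule_isNormed.Build (scalar_field R k) B2
  B2_normD B2_normZ B2_norm_eq0.

Definition Mltp : set B2 := [set m | associative (m : E -> E -> E)].

End BoundedBilinear.

Arguments B2 {R k} E.
Arguments Mltp {R k} E.

(* Main.v *)
Require Import Defs.
From mathcomp Require Import all_boot all_order all_algebra.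
From mathcomp Require Import all_classical all_reals topology normedtype.

(** Application [(f, u, v) |-> f u v] is jointly continuous from [B2 E * E * E]
    to [E] ([cvg_B2_apply]).  Hence, for fixed [x], [y] and [z], both sides of
    the associative law [m x (m y z) = m (m x y) z] depend continuously on [m],
    although [m] occurs twice in each.  As [E] is Hausdorff, the solutions [m]
    of each of these equations form a closed set, and [Mltp E] is the
    intersection of these closed sets. *)

Import Order.TTheory GRing.Theory Num.Theory.
Import numFieldNormedType.Exports.

Local Open Scope classical_set_scope.
Local Open Scope ring_scope.

Section Application.
Context {R : realType} {k : scalar_kind}.
Context {E : normedModType (scalar_field R k)}.
Implicit Types (f g : B2 E) (x y : E).

Lemma B2_linearl f y : linear (fun x => f x y).
Proof. by have [[fl _] _] := (bounded_bilinearP f).1 (valP f) => a u v; exact: fl. Qed.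

Lemma B2_linearr f x : linear (f x).
Proof. by have [[_ fr] _] := (bounded_bilinearP f).1 (valP f) => a u v; exact: fr. Qed.

Lemma B2_Zl f a x y : f (a *: x) y = a *: f x y.
Proof. exact: (scalable_linear (B2_linearl f y)). Qed.

Lemma B2_Zr f a x y : f x (a *: y) = a *: f x y.
Proof. exact: (scalable_linear (B2_linearr f x)). Qed.

Lemma B2_Bl f x x' y : f (x - x') y = f x y - f x' y.
Proof. exact: (zmod_morphism_linear (B2_linearl f y)). Qed.

Lemma B2_Br f x y y' : f x (y - y') = f x y - f x y'.
Proof. exact: (zmod_morphism_linear (B2_linearr f x)). Qed.

Lemma B2_0l f y : f 0 y = 0.
Proof. by rewrite -(scale0r (0 : E)) B2_Zl !scale0r. Qed.

Lemma B2_0r f x : f x 0 = 0.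
Proof. by rewrite -(scale0r (0 : E)) B2_Zr !scale0r. Qed.

(** The norm only bounds [f] on the unit ball; homogeneity in each argument
    carries the bound over to arbitrary vectors. *)
Lemma ler_norm_B2_apply f x y : `|f x y| <= `|f| * `|x| * `|y|.
Proof.
have [->|x0] := eqVneq x 0; first by rewrite B2_0l !normr0 mulr0 mul0r.
have [->|y0] := eqVneq y 0; first by rewrite B2_0r !normr0 mulr0.
have unit_normalize (z : E) : z != 0 -> unit_ball (`|z|^-1 *: z).
  by move=> z0; rewrite /unit_ball /= normrZ normfV normr_id mulVf ?normr_eq0.
have := ler_B2_norm f (unit_normalize x x0) (unit_normalize y y0).
rewrite B2_Zl B2_Zr !normrZ !normfV !normr_id.
by rewrite ler_pdivrMl ?normr_gt0// ler_pdivrMl ?normr_gt0// mulrC (mulrC `|x|).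
Qed.

(** Changing [f], then [u], then [v] to its limit one at a time writes the
    error as a sum of three terms, each linear in one of the differences
    [f t - g], [u t - x] and [v t - y] that tend to 0. *)
Lemma cvg_B2_apply {T : Type} {F : set_system T} {FF : Filter F}
    (f : T -> B2 E) (u v : T -> E) g x y :
  f @ F --> g -> u @ F --> x -> v @ F --> y ->
  (fun t => f t (u t) (v t)) @ F --> g x y.
Proof.
move=> fg ux vy.
pose b t := `|f t - g| * `|u t| * `|v t| +
  (`|g| * `|u t - x| * `|v t| + `|g| * `|x| * `|v t - y|).
have b0 : b @ F --> (0 : scalar_field R k).
  have -> : (0 : scalar_field R k) = `|g - g| * `|x| * `|y| +
      (`|g| * `|x - x| * `|y| + `|g| * `|x| * `|y - y|).
    by rewrite !subrr !normr0 !(mul0r, mulr0) !addr0.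
  apply: cvgD; [|apply: cvgD].
  - apply: cvgM; [apply: cvgM|]; apply: cvg_norm => //.
    by apply: cvgB => //; exact: cvg_cst.
  - apply: cvgM; [apply: cvgM; first exact: cvg_cst|]; apply: cvg_norm => //.
    by apply: cvgB => //; exact: cvg_cst.
  - apply: cvgM; first exact: cvg_cst.
    by apply: cvg_norm; apply: cvgB => //; exact: cvg_cst.
have leb t : `|f t (u t) (v t) - g x y| <= b t.
  have -> : f t (u t) (v t) - g x y =
      (f t - g) (u t) (v t) + (g (u t - x) (v t) + g x (v t - y)).
    rewrite B2_Bl B2_Br (_ : (f t - g) _ _ = f t (u t) (v t) - g (u t) (v t))//.
    by rewrite !addrA !subrK.
  apply: le_trans (ler_normD _ _) _; apply: lerD; first exact: ler_norm_B2_apply.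
  by apply: le_trans (ler_normD _ _) _; apply: lerD; exact: ler_norm_B2_apply.
(* The order on complex scalars is partial, so [b t] can only be
   compared with [`|b t|] once it is known to be nonnegative, hence real. *)
apply/cvgrPdist_lt => e e0.
have /cvgrPdist_lt/(_ _ e0) := b0; apply: filterS => t.
rewrite sub0r normrN distrC; apply: le_lt_trans.
by apply: (le_trans (leb t)); rewrite real_ler_norm// ger0_real// (le_trans _ (leb t)).
Qed.

(** In a nested product such as [m x (m y z)] the arguments of [m] depend on
    [m] as well, which is why joint continuity is needed. *)
Corollary continuous_B2_apply (u v : B2 E -> E) :
  continuous u -> continuous v -> continuous (fun m : B2 E => m (u m) (v m)).
Proof.
move=> cu cv m.
by apply: (cvg_B2_apply id u v) (cu m) (cv m); exact: cvg_id.
Qed.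

Lemma closed_Mltp : closed (Mltp E).
Proof.
have -> : Mltp E =
    \bigcap_(p in [set: E * E * E])
      (fun m : B2 E => m p.1.1 (m p.1.2 p.2) - m (m p.1.1 p.1.2) p.2) @^-1` [set 0].
  apply/seteqP; split=> [m mA p _|m mA x y z]; first by rewrite /= mA subrr.
  by apply/eqP; rewrite -subr_eq0; apply/eqP; exact: (mA (x, y, z)).
apply: closed_bigI => -[[x y] z] _ /=.
apply: (continuous_closedP _).1; last first.
  exact/accessible_closed_set1/hausdorff_accessible/norm_hausdorff.
have cst_cont (a : E) : continuous (fun _ : B2 E => a).
  exact: cst_continuous.
have nestr : continuous (fun m : B2 E => m x (m y z)).
  by apply: continuous_B2_apply => //; exact: continuous_B2_apply.
have nestl : continuous (fun m : B2 E => m (m x y) z).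
  by apply: continuous_B2_apply => //; exact: continuous_B2_apply.
by move=> m; exact: (cvgB (nestr m) (nestl m)).
Qed.

End Application.

Theorem theorem3p2 (R : realType) (k : scalar_kind)
  (E : completeNormedModType (scalar_field R k)) (E_neq0 : exists x : E, x != 0) :
  closed (Mltp E).
Proof.
exact: closed_Mltp.
Qed.
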